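(* Assume the vector variational inequality defined by $F$ and $K$ is monotone. If the weak Pareto solution set $\mathrm{Sol}^w(F,K)$ is disconnected, then each connected component of $\mathrm{Sol}^w(F,K)$ is unbounded.
   Context: Let $K\subset\mathbb{R}^n$ be a nonempty closed convex set and $F_1,\dots,F_m:K\to\mathbb{R}^n$ continuous functions; write $F=(F_1,\dots,F_m)$ and $F(x)(u)=(\langle F_1(x),u\rangle,\dots,\langle F_m(x),u\rangle)$. The problem is monotone if each $F_l$ is monotone on $K$: $\langle F_l(y)-F_l(x),y-x\rangle\ge0$ for all $x,y\in K$. The weak Pareto solution set $\mathrm{Sol}^w(F,K)$ is the set of $x\in K$ such that $F(x)(x-y)\notin\operatorname{int}\mathbb{R}^m_+$ for all $y\in K$. *)

(* Defs.v *)
From Stdlib Require Import Reals Arith.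
Open Scope R_scope.

Definition Idx (k : nat) : Type := {i : nat | (i < k)%nat}.

Definition Vec (n : nat) : Type := Idx n -> R.

Definition vsub {n : nat} (x y : Vec n) : Vec n := fun i => x i - y i.
Definition vadd {n : nat} (x y : Vec n) : Vec n := fun i => x i + y i.
Definition vscal {n : nat} (t : R) (x : Vec n) : Vec n := fun i => t * x i.

(* extension of a vector by 0 outside {0..n-1}, to sum over nat *)
Definition vext {n : nat} (x : Vec n) (k : nat) : R :=
  match Compare_dec.lt_dec k n with
  | left h => x (exist _ k h)
  | right _ => 0
  end.

Fixpoint sumR (f : nat -> R) (k : nat) : R :=
  match k with
  | O => 0
  | S j => sumR f j + f j
  end.

Definition dot {n : nat} (x y : Vec n) : R :=
  sumR (fun k => vext x k * vext y k) n.

Definition vnorm {n : nat} (x : Vec n) : R := sqrt (dot x x).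

Definition vset (n : nat) := Vec n -> Prop.

Definition is_open {n : nat} (U : vset n) : Prop :=
  forall x, U x -> exists eps, eps > 0 /\
    forall y, vnorm (vsub y x) < eps -> U y.

Definition is_closed {n : nat} (S : vset n) : Prop :=
  is_open (fun x => ~ S x).

Definition is_convex {n : nat} (S : vset n) : Prop :=
  forall x y t, S x -> S y -> 0 <= t <= 1 ->
    S (vadd (vscal t x) (vscal (1 - t) y)).

Definition continuous_on {n : nat} (K : vset n) (f : Vec n -> Vec n) : Prop :=
  forall x, K x -> forall eps, eps > 0 -> exists delta, delta > 0 /\
    forall y, K y -> vnorm (vsub y x) < delta -> vnorm (vsub (f y) (f x)) < eps.

Definition monotone_VVI {n m : nat} (F : Idx m -> Vec n -> Vec n) (K : vset n) : Prop :=
  forall l x y, K x -> K y -> dot (vsub (F l y) (F l x)) (vsub y x) >= 0.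

Definition in_int_Rplus {m : nat} (v : Idx m -> R) : Prop := forall l, v l > 0.

Definition Fapp {n m : nat} (F : Idx m -> Vec n -> Vec n) (x u : Vec n) : Idx m -> R :=
  fun l => dot (F l x) u.

Definition Solw {n m : nat} (F : Idx m -> Vec n -> Vec n) (K : vset n) : vset n :=
  fun x => K x /\ forall y, K y -> ~ in_int_Rplus (Fapp F x (vsub x y)).

Definition is_connected {n : nat} (S : vset n) : Prop :=
  ~ exists U V : vset n, is_open U /\ is_open V /\
      (forall x, S x -> U x \/ V x) /\
      (exists x, S x /\ U x) /\ (exists x, S x /\ V x) /\
      (forall x, S x -> U x -> V x -> False).

Definition subset {n : nat} (A B : vset n) : Prop := forall x, A x -> B x.

Definition is_component {n : nat} (S C : vset n) : Prop :=
  (exists x, C x) /\ subset C S /\ is_connected C /\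
  forall D, subset C D -> subset D S -> is_connected D -> subset D C.

Definition is_bounded {n : nat} (S : vset n) : Prop :=
  exists M, forall x, S x -> vnorm x <= M.

(* Main.v *)
(** By separation in R^m, the weak Pareto solutions are exactly the solutions of
    the scalarized problems with operator [sum_l xi_l F_l], [xi] in the unit
    simplex; by Minty's lemma each scalarized solution set is convex. Let [A] be
    a nonempty bounded relatively clopen subset of [Solw]. A scalarized solution
    set meeting [A] lies in [A], and the set of [xi] for which this happens is
    closed (compactness) and open (solve the problem truncated to a ball). Along
    the segment from such a [xi] to any other weight it is therefore everything,
    so [A] is all of [Solw]. A bounded component yields such an [A], namely the
    points of [Solw] in a larger ball reachable by [e]-chains for small [e];
    hence [Solw] is bounded. A disconnection of [Solw] then gives a proper
    nonempty bounded clopen subset, a contradiction. *)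

Require Import Defs.
From Stdlib Require Import Reals Lra Lia Classical List.
From Stdlib Require Import FunctionalExtensionality ProofIrrelevance IndefiniteDescription.
Open Scope R_scope.

(** * Euclidean vectors and cluster points *)

Ltac vec_eq :=
  apply functional_extensionality; intro; unfold vadd, vsub, vscal; try ring.

Lemma Rabs_le_inv a b : Rabs a <= b -> - b <= a <= b.
Proof. unfold Rabs. destruct Rcase_abs; lra. Qed.

Lemma sumR_ext f g k : (forall i, (i < k)%nat -> f i = g i) -> sumR f k = sumR g k.
Proof.
  induction k as [|k IH]; intros H; simpl; [reflexivity|].
  rewrite IH, H; [reflexivity | lia | intros; apply H; lia].
Qed.

Lemma sumR_le f g k : (forall i, (i < k)%nat -> f i <= g i) -> sumR f k <= sumR g k.
Proof.
  induction k as [|k IH]; intros H; simpl; [lra|].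
  apply Rplus_le_compat; [apply IH; intros; apply H|apply H]; lia.
Qed.

Lemma sumR_lin a b f g k :
  sumR (fun i => a * f i + b * g i) k = a * sumR f k + b * sumR g k.
Proof. induction k as [|k IH]; simpl; [ring|]. rewrite IH; ring. Qed.

Lemma sumR_const c k : sumR (fun _ => c) k = INR k * c.
Proof.
  induction k as [|k IH]; [simpl; ring|].
  rewrite S_INR; simpl sumR; rewrite IH; ring.
Qed.

Lemma sumR_ge0 f k : (forall i, (i < k)%nat -> 0 <= f i) -> 0 <= sumR f k.
Proof.
  intros H. replace 0 with (sumR (fun _ => 0) k) by (rewrite sumR_const; ring).
  now apply sumR_le.
Qed.

Lemma sumR_term_le f k j :
  (forall i, (i < k)%nat -> 0 <= f i) -> (j < k)%nat -> f j <= sumR f k.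
Proof.
  induction k as [|k IH]; intros H Hj; [lia|]; simpl.
  assert (H0 : forall i, (i < k)%nat -> 0 <= f i) by (intros; apply H; lia).
  pose proof (sumR_ge0 f k H0). pose proof (H k (Nat.lt_succ_diag_r k)).
  destruct (Nat.eq_dec j k) as [->|]; [lra|].
  assert (f j <= sumR f k) by (apply IH; [exact H0 | lia]). lra.
Qed.

Section Vectors.
Context {n : nat}.
Implicit Types (x y z u : Vec n) (t a : R).

Lemma vext_in x k (h : (k < n)%nat) : vext x k = x (exist _ k h).
Proof.
  unfold vext. destruct (Compare_dec.lt_dec k n) as [h'|]; [|lia].
  now rewrite (proof_irrelevance _ h' h).
Qed.

Lemma vext_lin a b x y k :
  vext (vadd (vscal a x) (vscal b y)) k = a * vext x k + b * vext y k.
Proof. unfold vext, vadd, vscal. destruct Compare_dec.lt_dec; ring. Qed.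

Lemma dot_comm x y : dot x y = dot y x.
Proof. apply sumR_ext; intros; ring. Qed.

Lemma dot_lin_l a b x y u :
  dot (vadd (vscal a x) (vscal b y)) u = a * dot x u + b * dot y u.
Proof.
  unfold dot. rewrite <- sumR_lin. apply sumR_ext; intros.
  rewrite vext_lin; ring.
Qed.

Lemma dot_add_l x y u : dot (vadd x y) u = dot x u + dot y u.
Proof.
  replace (vadd x y) with (vadd (vscal 1 x) (vscal 1 y)) by vec_eq.
  rewrite dot_lin_l; ring.
Qed.

Lemma dot_sub_l x y u : dot (vsub x y) u = dot x u - dot y u.
Proof.
  replace (vsub x y) with (vadd (vscal 1 x) (vscal (-1) y)) by vec_eq.
  rewrite dot_lin_l; ring.
Qed.

Lemma dot_scal_l a x u : dot (vscal a x) u = a * dot x u.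
Proof.
  replace (vscal a x) with (vadd (vscal a x) (vscal 0 x)) by vec_eq.
  rewrite dot_lin_l; ring.
Qed.

Lemma dot_add_r x y u : dot u (vadd x y) = dot u x + dot u y.
Proof. rewrite !(dot_comm u); apply dot_add_l. Qed.

Lemma dot_sub_r x y u : dot u (vsub x y) = dot u x - dot u y.
Proof. rewrite !(dot_comm u); apply dot_sub_l. Qed.

Lemma dot_scal_r a x u : dot u (vscal a x) = a * dot u x.
Proof. rewrite !(dot_comm u); apply dot_scal_l. Qed.

Lemma dot_ge0 x : 0 <= dot x x.
Proof. apply sumR_ge0; intros; nra. Qed.

Lemma vnorm_ge0 x : 0 <= vnorm x.
Proof. apply sqrt_pos. Qed.

Lemma vnorm_sqr x : vnorm x * vnorm x = dot x x.
Proof. apply sqrt_sqrt, dot_ge0. Qed.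

Lemma dot_le x y : dot x y <= vnorm x * vnorm y.
Proof.
  pose proof (vnorm_ge0 x) as Hx. pose proof (vnorm_ge0 y) as Hy.
  assert (H : forall s t, 0 <= s * s * (vnorm x * vnorm x)
    - 2 * (s * t * dot x y) + t * t * (vnorm y * vnorm y)).
  { intros s t. pose proof (dot_ge0 (vsub (vscal s x) (vscal t y))) as H.
    repeat rewrite ?dot_sub_l, ?dot_sub_r, ?dot_scal_l, ?dot_scal_r in H.
    rewrite (dot_comm y x), <- !vnorm_sqr in H. lra. }
  apply Rnot_lt_le; intro Hlt.
  set (X := vnorm x) in *. set (Y := vnorm y) in *. set (d := dot x y) in *.
  assert (Hd : X * X * (Y * Y) < d * d).
  { assert (0 <= X * Y) by now apply Rmult_le_pos.
    replace (X * X * (Y * Y)) with (X * Y * (X * Y)) by ring. nra. }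
  pose proof (H d (X * X)) as H1. pose proof (H (Y * Y) d) as H2.
  replace (_ - _ + _) with (- (X * X) * (d * d - X * X * (Y * Y))) in H1 by ring.
  replace (_ - _ + _) with (- (Y * Y) * (d * d - X * X * (Y * Y))) in H2 by ring.
  assert (X * X = 0) by nra. assert (Y * Y = 0) by nra.
  pose proof (H 1 1). nra.
Qed.

Lemma Rabs_dot_le x y : Rabs (dot x y) <= vnorm x * vnorm y.
Proof.
  apply Rabs_le; split; [|apply dot_le].
  pose proof (dot_le (vscal (-1) x) y) as H. rewrite dot_scal_l in H.
  replace (vnorm (vscal (-1) x)) with (vnorm x) in H; [lra|].
  unfold vnorm. rewrite dot_scal_l, dot_scal_r. f_equal; ring.
Qed.

Lemma vnorm_le_sqr x a : 0 <= a -> dot x x <= a * a -> vnorm x <= a.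
Proof. intros Ha H. rewrite <- vnorm_sqr in H. pose proof (vnorm_ge0 x). nra. Qed.

Lemma vnorm_add x y : vnorm (vadd x y) <= vnorm x + vnorm y.
Proof.
  pose proof (vnorm_ge0 x). pose proof (vnorm_ge0 y).
  apply vnorm_le_sqr; [lra|].
  rewrite dot_add_l, !dot_add_r, (dot_comm y x), <- !vnorm_sqr.
  pose proof (dot_le x y). nra.
Qed.

Lemma vnorm_scal a x : vnorm (vscal a x) = Rabs a * vnorm x.
Proof.
  unfold vnorm. rewrite dot_scal_l, dot_scal_r, <- Rmult_assoc.
  rewrite sqrt_mult; [|nra|apply dot_ge0]. f_equal. apply sqrt_Rsqr_abs.
Qed.

Lemma vnorm_sub_sym x y : vnorm (vsub x y) = vnorm (vsub y x).
Proof.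
  replace (vsub x y) with (vscal (-1) (vsub y x)) by vec_eq.
  rewrite vnorm_scal, Rabs_left by lra; ring.
Qed.

Lemma vnorm_sub_triangle x y z :
  vnorm (vsub x z) <= vnorm (vsub x y) + vnorm (vsub y z).
Proof.
  replace (vsub x z) with (vadd (vsub x y) (vsub y z)) by vec_eq.
  apply vnorm_add.
Qed.

Lemma vnorm_le_sub x y : vnorm x <= vnorm y + vnorm (vsub x y).
Proof.
  replace x with (vadd y (vsub x y)) at 1 by vec_eq. apply vnorm_add.
Qed.

Lemma vnorm_sub_le x y : vnorm (vsub x y) <= vnorm x + vnorm y.
Proof.
  replace (vsub x y) with (vadd x (vscal (-1) y)) by vec_eq.
  eapply Rle_trans; [apply vnorm_add|].
  rewrite vnorm_scal, Rabs_left by lra; lra.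
Qed.

Lemma vnorm_sub_diag x : vnorm (vsub x x) = 0.
Proof.
  replace (vsub x x) with (vscal 0 x) by vec_eq.
  rewrite vnorm_scal, Rabs_R0; ring.
Qed.

Lemma vext_le_vnorm x k : Rabs (vext x k) <= vnorm x.
Proof.
  pose proof (vnorm_ge0 x). destruct (Nat.lt_ge_cases k n) as [Hk|Hk].
  - assert (vext x k * vext x k <= dot x x).
    { apply (sumR_term_le (fun k => vext x k * vext x k)); [intros; nra | exact Hk]. }
    rewrite <- vnorm_sqr in *. apply Rabs_le; split; nra.
  - unfold vext. destruct Compare_dec.lt_dec; [lia|]. now rewrite Rabs_R0.
Qed.

Lemma vnorm_le_coord x a :
  0 <= a -> (forall k, (k < n)%nat -> Rabs (vext x k) <= a) ->
  vnorm x <= (INR n + 1) * a.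
Proof.
  intros Ha H. pose proof (pos_INR n).
  apply vnorm_le_sqr; [nra|].
  apply Rle_trans with (sumR (fun _ => a * a) n).
  - apply sumR_le; intros k Hk. specialize (H k Hk).
    apply Rabs_le_inv in H. nra.
  - rewrite sumR_const. nra.
Qed.

End Vectors.

Definition cluster {n} (u : nat -> Vec n) (x : Vec n) : Prop :=
  forall eps N, eps > 0 -> exists k, (N <= k)%nat /\ vnorm (vsub (u k) x) < eps.

Lemma inv_INR_small eps :
  eps > 0 -> exists N, forall k, (N <= k)%nat -> / (INR k + 1) < eps.
Proof.
  intros He. destruct (archimed_cor1 eps He) as [N [H1 H2]].
  exists N. intros k Hk. apply Rle_lt_trans with (/ INR N); [|exact H1].
  apply Rinv_le_contravar; [now apply (lt_INR 0)|].
  apply le_INR in Hk. lra.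
Qed.

Lemma inv_INR_pos k : 0 < / (INR k + 1).
Proof. apply Rinv_0_lt_compat. pose proof (pos_INR k). lra. Qed.

Lemma bounded_real_cluster (v : nat -> R) M :
  (forall k, Rabs (v k) <= M) ->
  exists l, forall eps N, eps > 0 -> exists k, (N <= k)%nat /\ Rabs (v k - l) < eps.
Proof.
  intros H.
  destruct (Bolzano_Weierstrass v (fun c => - M <= c <= M)) as [l Hl].
  - apply compact_P3.
  - intros k. apply Rabs_le_inv, H.
  - exists l. intros eps N He.
    destruct (Hl (disc l (mkposreal eps He)) N) as [k [Hk1 Hk2]].
    + now exists (mkposreal eps He).
    + exists k. split; assumption.
Qed.

(* Coordinates are made to converge one at a time; at each step [phi] is a
   subsequence along which the previous ones converge. *)
Lemma bounded_cluster {n} (u : nat -> Vec n) M :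
  (forall k, vnorm (u k) <= M) -> exists x, cluster u x.
Proof.
  intros HM.
  assert (H : forall j, exists l : nat -> R, forall eps N, eps > 0 -> exists k,
    (N <= k)%nat /\ forall i, (i < j)%nat -> Rabs (vext (u k) i - l i) < eps).
  { induction j as [|j [l IH]].
    - exists (fun _ => 0). intros eps N _. exists N. split; [lia|]. intros; lia.
    - assert (IH' : forall N, exists k, (N <= k)%nat /\ forall i, (i < j)%nat ->
        Rabs (vext (u k) i - l i) < / (INR N + 1)).
      { intros N. apply IH, inv_INR_pos. }
      apply functional_choice in IH'. destruct IH' as [phi Hphi].
      destruct (bounded_real_cluster (fun N => vext (u (phi N)) j) M) as [c Hc].
      { intros k. eapply Rle_trans; [apply vext_le_vnorm | apply HM]. }
      exists (fun i => if Nat.eq_dec i j then c else l i).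
      intros eps N He. destruct (inv_INR_small eps He) as [N0 HN0].
      destruct (Hc eps (N + N0)%nat He) as [k [Hk1 Hk2]].
      destruct (Hphi k) as [Hp1 Hp2].
      exists (phi k). split; [lia|]. intros i Hi.
      destruct (Nat.eq_dec i j) as [->|Hij]; [exact Hk2|].
      eapply Rlt_trans; [apply Hp2; lia | apply HN0; lia]. }
  destruct (H n) as [l Hl].
  exists (fun i => l (proj1_sig i)). intros eps N He.
  pose proof (pos_INR n) as Hn.
  assert (He' : eps / (INR n + 2) > 0) by (apply Rdiv_lt_0_compat; lra).
  destruct (Hl _ N He') as [k [Hk1 Hk2]].
  exists k. split; [exact Hk1|].
  apply Rle_lt_trans with ((INR n + 1) * (eps / (INR n + 2))).
  - apply vnorm_le_coord; [lra|]. intros i Hi. rewrite (vext_in _ _ Hi).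
    unfold vsub. rewrite <- vext_in. apply Rlt_le, Hk2, Hi.
  - apply Rmult_lt_reg_r with (INR n + 2); [lra|]. field_simplify; nra.
Qed.

Lemma closed_cluster {n} (S : vset n) u x :
  is_closed S -> (forall k, S (u k)) -> cluster u x -> S x.
Proof.
  intros Hc Hu Hx. apply NNPP; intro Hn.
  destruct (Hc x Hn) as [eps [He Hball]].
  destruct (Hx eps 0%nat He) as [k [_ Hk]].
  exact (Hball _ Hk (Hu k)).
Qed.

Lemma dot_cluster_ge0 {n} (u : nat -> Vec n) x (a y : Vec n) :
  cluster u x ->
  (forall eps, eps > 0 -> exists N, forall k, (N <= k)%nat ->
    - eps <= dot a (vsub y (u k))) ->
  0 <= dot a (vsub y x).
Proof.
  intros Hx H. apply Rnot_lt_le; intro Hlt.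
  set (eta := - dot a (vsub y x)) in *.
  assert (Heta : 0 < eta) by (unfold eta; lra).
  pose proof (vnorm_ge0 a) as Ha.
  destruct (H (eta / 2) ltac:(lra)) as [N HN].
  destruct (Hx (eta / 2 / (vnorm a + 1)) N) as [k [Hk1 Hk2]].
  { apply Rdiv_lt_0_compat; lra. }
  specialize (HN k Hk1).
  assert (E : dot a (vsub y (u k)) = - eta - dot a (vsub (u k) x)).
  { unfold eta. rewrite !dot_sub_r; ring. }
  pose proof (Rabs_dot_le a (vsub (u k) x)) as Hd. apply Rabs_le_inv in Hd.
  assert (vnorm (vsub (u k) x) * (vnorm a + 1) < eta / 2).
  { apply Rmult_lt_reg_r with (/ (vnorm a + 1)); [apply Rinv_0_lt_compat; lra|].
    rewrite Rmult_assoc, Rinv_r, Rmult_1_r by lra. exact Hk2. }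
  pose proof (vnorm_ge0 (vsub (u k) x)). nra.
Qed.

Lemma bounded_finite_net {n} (K : vset n) M eps :
  (forall x, K x -> vnorm x <= M) -> eps > 0 ->
  exists l : list (Vec n), (forall y, In y l -> K y) /\
    forall x, K x -> exists y, In y l /\ vnorm (vsub x y) < eps.
Proof.
  intros HM He. apply NNPP; intro Hno.
  assert (Hf : forall l : list (Vec n), exists x, (forall y, In y l -> K y) ->
    K x /\ forall y, In y l -> eps <= vnorm (vsub x y)).
  { intros l. apply NNPP; intro H1. apply Hno. exists l. split.
    - apply NNPP; intro H2. apply H1. exists (fun _ => 0). intro H3; tauto.
    - intros x Kx. apply NNPP; intro H2. apply H1. exists x. intros _.
      split; [exact Kx|]. intros y Hy. apply Rnot_lt_le; intro Hlt.
      apply H2. now exists y. }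
  apply functional_choice in Hf. destruct Hf as [f Hf].
  set (L := fix L k := match k with O => nil | S j => f (L j) :: L j end).
  assert (HL : forall k y, In y (L k) -> K y).
  { induction k as [|k IH]; simpl; [tauto|]. intros y [<-|Hy]; [|now apply IH].
    apply Hf, IH. }
  assert (Hin : forall j i, (i < j)%nat -> In (f (L i)) (L j)).
  { induction j as [|j IH]; intros i Hi; [lia|]. simpl.
    destruct (Nat.eq_dec i j) as [->|]; [now left|]. right. apply IH; lia. }
  destruct (bounded_cluster (fun k => f (L k)) M) as [x Hx].
  { intros k. apply HM, Hf, HL. }
  destruct (Hx (eps / 2) 0%nat ltac:(lra)) as [i [_ Hi]].
  destruct (Hx (eps / 2) (S i) ltac:(lra)) as [j [Hij Hj]].
  destruct (Hf (L j) (HL j)) as [_ Hfar].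
  specialize (Hfar _ (Hin j i Hij)).
  pose proof (vnorm_sub_triangle (f (L j)) x (f (L i))).
  rewrite (vnorm_sub_sym x) in *. lra.
Qed.

(** * Convex alternatives *)

Definition affine {n} (g : Vec n -> R) : Prop :=
  forall x y t, g (vadd (vscal t x) (vscal (1 - t) y)) = t * g x + (1 - t) * g y.

Definition weights (xi : nat -> R) (k : nat) : Prop :=
  (forall i, (i < k)%nat -> 0 <= xi i) /\ sumR xi k = 1.

(* The admissible [lambda] form an interval: each point with [h > 0] gives a
   lower bound, each point with [g > 0] an upper bound, and convexity makes the
   bounds compatible. *)
Lemma convex_alternative2 {n} (X : vset n) (g h : Vec n -> R) :
  is_convex X -> affine g -> affine h ->
  (forall x, X x -> ~ (g x > 0 /\ h x > 0)) ->
  exists lambda, 0 <= lambda <= 1 /\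
    forall x, X x -> lambda * g x + (1 - lambda) * h x <= 0.
Proof.
  intros HX Hg Hh Hno.
  assert (Hcross : forall x y, X x -> X y -> g x > 0 -> h y > 0 ->
    h x <= 0 /\ g y <= 0 /\ g x * h y <= h x * g y).
  { intros x y Xx Xy Hx Hy.
    assert (h x <= 0) by (apply Rnot_lt_le; intro; apply (Hno x Xx); lra).
    assert (g y <= 0) by (apply Rnot_lt_le; intro; apply (Hno y Xy); lra).
    repeat split; try assumption. apply Rnot_lt_le; intro Hlt.
    set (p := h y - g y). set (q := g x - h x).
    assert (Hp : 0 < p) by (unfold p; lra). assert (Hq : 0 < q) by (unfold q; lra).
    assert (Hpq : 0 < / (p + q)) by (apply Rinv_0_lt_compat; lra).
    assert (Ht : 1 - p / (p + q) = q / (p + q)) by (field; lra).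
    assert (H01 : 0 <= p / (p + q) <= 1).
    { assert (0 < p / (p + q)) by now apply Rmult_lt_0_compat.
      assert (0 < q / (p + q)) by now apply Rmult_lt_0_compat. lra. }
    apply (Hno _ (HX x y _ Xx Xy H01)). rewrite Hg, Hh, Ht. split.
    - replace (_ + _) with ((g x * h y - h x * g y) * / (p + q))
        by (unfold p, q; field; unfold p, q in *; lra).
      apply Rmult_lt_0_compat; lra.
    - replace (_ + _) with ((g x * h y - h x * g y) * / (p + q))
        by (unfold p, q; field; unfold p, q in *; lra).
      apply Rmult_lt_0_compat; lra. }
  destruct (classic (exists b, X b /\ h b > 0)) as [[b [Xb Hb]]|Hnb].
  2: { exists 0. split; [lra|]. intros x Xx. apply Rnot_lt_le; intro.
       apply Hnb. exists x. split; [assumption | lra]. }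
  destruct (classic (exists a, X a /\ g a > 0)) as [[a [Xa Ha]]|Hna].
  2: { exists 1. split; [lra|]. intros x Xx. apply Rnot_lt_le; intro.
       apply Hna. exists x. split; [assumption | lra]. }
  set (E r := exists y, X y /\ h y > 0 /\ r * (h y - g y) = h y).
  assert (HE : forall y, X y -> h y > 0 -> E (h y / (h y - g y))).
  { intros y Xy Hy. destruct (Hcross a y Xa Xy Ha Hy) as (_ & ? & _).
    exists y. repeat split; try assumption. field. lra. }
  assert (HEx : forall r x, E r -> X x -> g x > 0 -> r * (g x - h x) <= - h x).
  { intros r x [y (Xy & Hy & Hr)] Xx Hx.
    destruct (Hcross x y Xx Xy Hx Hy) as (? & ? & ?).
    replace r with (h y / (h y - g y)) by (rewrite <- Hr at 1; field; lra).
    apply Rmult_le_reg_r with (h y - g y); [lra|].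
    replace (h y / (h y - g y) * (g x - h x) * (h y - g y))
      with (h y * (g x - h x)) by (field; lra). lra. }
  assert (HE01 : forall r, E r -> 0 <= r <= 1).
  { intros r [y (Xy & Hy & Hr)].
    destruct (Hcross a y Xa Xy Ha Hy) as (_ & ? & _). split; nra. }
  destruct (completeness E) as [s [Hub Hlub]].
  { exists 1. intros r Hr. apply HE01, Hr. }
  { exists (h b / (h b - g b)). now apply HE. }
  assert (Hs : 0 <= s <= 1).
  { split.
    - apply Rle_trans with (h b / (h b - g b)); [apply HE01|apply Hub]; now apply HE.
    - apply Hlub. intros r Hr. apply HE01, Hr. }
  exists s. split; [exact Hs|]. intros x Xx.
  destruct (Rlt_le_dec 0 (g x)) as [Hgx|Hgx].
  - assert (Hsx : s <= - h x / (g x - h x)).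
    { destruct (Hcross x b Xx Xb Hgx Hb) as (? & _ & _). apply Hlub.
      intros r Hr. apply Rmult_le_reg_r with (g x - h x); [lra|].
      replace (- h x / (g x - h x) * (g x - h x)) with (- h x) by (field; lra).
      now apply HEx. }
    destruct (Hcross x b Xx Xb Hgx Hb) as (? & _ & _).
    apply Rmult_le_compat_r with (r := g x - h x) in Hsx; [|lra].
    replace (- h x / (g x - h x) * (g x - h x)) with (- h x) in Hsx by (field; lra).
    lra.
  - destruct (Rlt_le_dec 0 (h x)) as [Hhx|Hhx]; [|nra].
    pose proof (Hub _ (HE x Xx Hhx)) as Hsx.
    apply Rmult_le_compat_r with (r := h x - g x) in Hsx; [|lra].
    replace (h x / (h x - g x) * (h x - g x)) with (h x) in Hsx by (field; lra).
    lra.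
Qed.

Lemma affine_sumR {n} (g : nat -> Vec n -> R) (xi : nat -> R) k :
  (forall i, (i < k)%nat -> affine (g i)) ->
  affine (fun x => sumR (fun i => xi i * g i x) k).
Proof.
  intros Hg x y t. simpl. rewrite <- sumR_lin. apply sumR_ext. intros i Hi.
  rewrite (Hg i Hi). ring.
Qed.

Lemma convex_alternative {n} k (X : vset n) (g : nat -> Vec n -> R) :
  (exists x, X x) -> is_convex X -> (forall i, (i < k)%nat -> affine (g i)) ->
  (forall x, X x -> ~ forall i, (i < k)%nat -> g i x > 0) ->
  exists xi, weights xi k /\
    forall x, X x -> sumR (fun i => xi i * g i x) k <= 0.
Proof.
  revert X. induction k as [|k IH]; intros X [x0 X0] HX Hg Hno.
  { exfalso. apply (Hno x0 X0). intros; lia. }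
  set (X' := fun x => X x /\ g k x > 0).
  assert (Hgk : affine (g k)) by (apply Hg; lia).
  assert (HX' : is_convex X').
  { intros x y t [Xx Hx] [Xy Hy] Ht. split; [now apply HX|]. rewrite Hgk. nra. }
  destruct (classic (exists x, X' x)) as [Hne|Hemp].
  - destruct (IH X' Hne HX') as [xi [[Hxi0 Hxi1] Hxi]].
    { intros; apply Hg; lia. }
    { intros x [Xx Hx] H. apply (Hno x Xx). intros i Hi.
      destruct (Nat.eq_dec i k) as [->|]; [exact Hx | apply H; lia]. }
    destruct (convex_alternative2 X
      (fun x => sumR (fun i => xi i * g i x) k) (g k) HX) as [l [Hl Hlx]].
    { apply affine_sumR. intros; apply Hg; lia. }
    { exact Hgk. }
    { intros x Xx [H1 H2]. specialize (Hxi x (conj Xx H2)). lra. }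
    set (zeta := fun i => if Nat.eq_dec i k then 1 - l else l * xi i).
    assert (Hzk : zeta k = 1 - l)
      by (unfold zeta; destruct Nat.eq_dec; [reflexivity|lia]).
    assert (Hzi : forall i, (i < k)%nat -> zeta i = l * xi i)
      by (intros; unfold zeta; destruct Nat.eq_dec; [lia|reflexivity]).
    exists zeta. repeat split.
    + intros i Hi. destruct (Nat.eq_dec i k) as [->|]; [lra|].
      rewrite Hzi by lia. apply Rmult_le_pos; [lra | apply Hxi0; lia].
    + simpl. rewrite Hzk, (sumR_ext _ (fun i => l * xi i + 0 * xi i)).
      * rewrite sumR_lin, Hxi1. ring.
      * intros i Hi. rewrite Hzi by lia. ring.
    + intros x Xx. simpl. rewrite Hzk.
      rewrite (sumR_ext _ (fun i => l * (xi i * g i x) + 0 * 0)).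
      * rewrite sumR_lin, sumR_const. specialize (Hlx x Xx). simpl in Hlx. lra.
      * intros i Hi. rewrite Hzi by lia. ring.
  - set (zeta := fun i => if Nat.eq_dec i k then 1 else 0).
    assert (Hzk : zeta k = 1)
      by (unfold zeta; destruct Nat.eq_dec; [reflexivity|lia]).
    assert (Hzi : forall i, (i < k)%nat -> zeta i = 0)
      by (intros; unfold zeta; destruct Nat.eq_dec; [lia|reflexivity]).
    exists zeta. repeat split.
    + intros i Hi. unfold zeta. destruct Nat.eq_dec; lra.
    + simpl. rewrite Hzk, (sumR_ext _ (fun _ => 0)) by exact Hzi.
      rewrite sumR_const. ring.
    + intros x Xx. simpl. rewrite Hzk, (sumR_ext _ (fun _ => 0)).
      * rewrite sumR_const, Rmult_0_r, Rplus_0_l, Rmult_1_l.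
        apply Rnot_lt_le; intro. apply Hemp. exists x. split; assumption.
      * intros i Hi. rewrite Hzi by exact Hi. ring.
Qed.

Fixpoint vsum {n} (V : nat -> Vec n) (k : nat) : Vec n :=
  match k with
  | O => fun _ => 0
  | S j => vadd (vsum V j) (V j)
  end.

Lemma dot_zero_l {n} (u : Vec n) : dot (fun _ => 0) u = 0.
Proof.
  replace (fun _ : Idx n => 0) with (vscal 0 u) by vec_eq.
  rewrite dot_scal_l. ring.
Qed.

Lemma dot_vsum_l {n} (V : nat -> Vec n) u k :
  dot (vsum V k) u = sumR (fun i => dot (V i) u) k.
Proof.
  induction k as [|k IH]; simpl; [apply dot_zero_l|]. now rewrite dot_add_l, IH.
Qed.

Lemma convex_vsum {n} (K : vset n) (xi : nat -> R) (y : nat -> Vec n) k :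
  is_convex K -> weights xi k -> (forall i, (i < k)%nat -> K (y i)) ->
  K (vsum (fun i => vscal (xi i) (y i)) k).
Proof.
  intros HK [Hxi Hsum] Hy.
  assert (Hk : exists z, K z).
  { destruct k; [simpl in Hsum; lra|]. exists (y 0%nat). apply Hy; lia. }
  enough (exists z, K z /\ vsum (fun i => vscal (xi i) (y i)) k = vscal (sumR xi k) z)
    as [z [Kz ->]].
  { rewrite Hsum. now replace (vscal 1 z) with z by vec_eq. }
  clear Hsum. induction k as [|k IH].
  { destruct Hk as [z Kz]. exists z. split; [exact Kz|]. simpl. vec_eq. }
  destruct IH as [z [Kz E]]; try (intros; (apply Hxi || apply Hy); lia).
  assert (Hs : 0 <= sumR xi k) by (apply sumR_ge0; intros; apply Hxi; lia).
  assert (Hk0 : 0 <= xi k) by (apply Hxi; lia).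
  simpl. rewrite E. destruct (Req_dec (sumR xi k + xi k) 0) as [H0|H0].
  - exists z. split; [exact Kz|].
    assert (E1 : sumR xi k = 0) by lra. assert (E2 : xi k = 0) by lra.
    rewrite E1, E2. vec_eq.
  - exists (vadd (vscal (sumR xi k / (sumR xi k + xi k)) z)
      (vscal (1 - sumR xi k / (sumR xi k + xi k)) (y k))). split.
    + apply HK; [exact Kz | apply Hy; lia|].
      assert (0 < / (sumR xi k + xi k)) by (apply Rinv_0_lt_compat; lra).
      assert (0 <= sumR xi k / (sumR xi k + xi k)) by (apply Rmult_le_pos; lra).
      assert (0 <= xi k / (sumR xi k + xi k)) by (apply Rmult_le_pos; lra).
      assert (sumR xi k / (sumR xi k + xi k) + xi k / (sumR xi k + xi k) = 1)
        by (field; lra). lra.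
    + vec_eq. field. exact H0.
Qed.

(** * Monotone variational inequalities *)

Lemma continuous_on_lin {n} (K : vset n) (f g : Vec n -> Vec n) a :
  continuous_on K f -> continuous_on K g ->
  continuous_on K (fun x => vadd (f x) (vscal a (g x))).
Proof.
  intros Hf Hg x Kx eps He.
  pose proof (Rabs_pos a) as Ha.
  assert (He' : eps / 2 / (Rabs a + 1) > 0)
    by (repeat apply Rdiv_lt_0_compat; lra).
  destruct (Hf x Kx (eps / 2) ltac:(lra)) as [d1 [Hd1 H1]].
  destruct (Hg x Kx _ He') as [d2 [Hd2 H2]].
  exists (Rmin d1 d2). split; [now apply Rmin_glb_lt|]. intros y Ky Hy.
  specialize (H1 y Ky (Rlt_le_trans _ _ _ Hy (Rmin_l _ _))).
  specialize (H2 y Ky (Rlt_le_trans _ _ _ Hy (Rmin_r _ _))).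
  replace (vsub _ _) with (vadd (vsub (f y) (f x)) (vscal a (vsub (g y) (g x))))
    by vec_eq.
  eapply Rle_lt_trans; [apply vnorm_add|]. rewrite vnorm_scal.
  assert ((Rabs a + 1) * vnorm (vsub (g y) (g x)) < eps / 2).
  { apply Rmult_lt_reg_r with (/ (Rabs a + 1)); [apply Rinv_0_lt_compat; lra|].
    replace ((Rabs a + 1) * vnorm (vsub (g y) (g x)) * / (Rabs a + 1))
      with (vnorm (vsub (g y) (g x))) by (field; lra). exact H2. }
  pose proof (vnorm_ge0 (vsub (g y) (g x))). lra.
Qed.

Definition comb {n} (G : nat -> Vec n -> Vec n) (xi : nat -> R) (k : nat)
  (x : Vec n) : Vec n := vsum (fun i => vscal (xi i) (G i x)) k.

Lemma dot_comb_l {n} (G : nat -> Vec n -> Vec n) xi k x u :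
  dot (comb G xi k x) u = sumR (fun i => xi i * dot (G i x) u) k.
Proof.
  unfold comb. rewrite dot_vsum_l. apply sumR_ext; intros. apply dot_scal_l.
Qed.

Lemma continuous_on_comb {n} (K : vset n) (G : nat -> Vec n -> Vec n) xi k :
  (forall i, (i < k)%nat -> continuous_on K (G i)) ->
  continuous_on K (comb G xi k).
Proof.
  induction k as [|k IH]; intros H.
  - intros x _ eps He. exists 1. split; [lra|]. intros. unfold comb; simpl.
    rewrite vnorm_sub_diag. lra.
  - apply (continuous_on_lin K (comb G xi k) (G k) (xi k));
      [apply IH; intros|]; apply H; lia.
Qed.

Definition monotone_on {n} (K : vset n) (G : Vec n -> Vec n) : Prop :=
  forall x y, K x -> K y -> 0 <= dot (vsub (G y) (G x)) (vsub y x).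

Lemma monotone_on_comb {n} (K : vset n) (G : nat -> Vec n -> Vec n) xi k :
  weights xi k -> (forall i, (i < k)%nat -> monotone_on K (G i)) ->
  monotone_on K (comb G xi k).
Proof.
  intros [Hxi _] H x y Kx Ky. rewrite dot_sub_l, !dot_comb_l.
  replace (_ - _) with (1 * sumR (fun i => xi i * dot (G i y) (vsub y x)) k
    + (-1) * sumR (fun i => xi i * dot (G i x) (vsub y x)) k) by ring.
  rewrite <- sumR_lin. apply sumR_ge0. intros i Hi.
  specialize (H i Hi x y Kx Ky). rewrite dot_sub_l in H.
  specialize (Hxi i Hi). nra.
Qed.

Definition VI {n} (G : Vec n -> Vec n) (K : vset n) (x : Vec n) : Prop :=
  K x /\ forall y, K y -> 0 <= dot (G x) (vsub y x).

Definition Minty {n} (G : Vec n -> Vec n) (K : vset n) (x : Vec n) : Prop :=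
  K x /\ forall y, K y -> 0 <= dot (G y) (vsub y x).

Lemma VI_Minty {n} (G : Vec n -> Vec n) K x :
  monotone_on K G -> VI G K x -> Minty G K x.
Proof.
  intros Hm [Kx Hx]. split; [exact Kx|]. intros y Ky.
  specialize (Hm x y Kx Ky). rewrite dot_sub_l in Hm. specialize (Hx y Ky). lra.
Qed.

Lemma small_scale a b :
  0 <= a -> 0 < b -> exists t, 0 < t <= 1 /\ t * a < b.
Proof.
  intros Ha Hb. exists (b / (a + b)).
  assert (Hab : 0 < / (a + b)) by (apply Rinv_0_lt_compat; lra).
  assert (0 < b / (a + b)) by (now apply Rmult_lt_0_compat).
  assert (E : b / (a + b) + a * / (a + b) = 1) by (field; lra).
  assert (0 <= a * / (a + b)) by (apply Rmult_le_pos; lra).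
  split; [lra|].
  replace (b / (a + b) * a) with (b * (a * / (a + b))) by (field; lra). nra.
Qed.

Lemma Minty_VI {n} (G : Vec n -> Vec n) K x :
  is_convex K -> continuous_on K G -> Minty G K x -> VI G K x.
Proof.
  intros HK Hc [Kx Hx]. split; [exact Kx|]. intros y Ky.
  apply Rnot_lt_le; intro Hlt.
  pose proof (vnorm_ge0 (vsub y x)) as Hyx.
  destruct (small_scale _ (- dot (G x) (vsub y x)) Hyx ltac:(lra))
    as [e [[He _] Hee]].
  destruct (Hc x Kx e He) as [d [Hd Hcd]].
  destruct (small_scale _ d Hyx Hd) as [t [Ht Htd]].
  set (z := vadd (vscal t y) (vscal (1 - t) x)).
  assert (Kz : K z) by (apply HK; [assumption..|lra]).
  assert (Ez : vsub z x = vscal t (vsub y x)) by (unfold z; vec_eq).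
  specialize (Hx z Kz). specialize (Hcd z Kz).
  rewrite Ez, dot_scal_r in Hx. rewrite Ez, vnorm_scal, Rabs_pos_eq in Hcd by lra.
  specialize (Hcd Htd).
  assert (0 <= dot (G z) (vsub y x)) by nra.
  pose proof (dot_le (vsub (G z) (G x)) (vsub y x)) as Hd'.
  rewrite dot_sub_l in Hd'. nra.
Qed.

Lemma VI_convex {n} (G : Vec n -> Vec n) K :
  is_convex K -> continuous_on K G -> monotone_on K G -> is_convex (VI G K).
Proof.
  intros HK Hc Hm x y t Hx Hy Ht.
  apply VI_Minty in Hx; [|exact Hm]. apply VI_Minty in Hy; [|exact Hm].
  apply Minty_VI; try assumption. destruct Hx as [Kx Hx], Hy as [Ky Hy].
  split; [now apply HK|]. intros z Kz. specialize (Hx z Kz). specialize (Hy z Kz).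
  replace (vsub z _) with (vadd (vscal t (vsub z x)) (vscal (1 - t) (vsub z y)))
    by vec_eq.
  rewrite dot_add_r, !dot_scal_r. nra.
Qed.

Definition ball_in {n} (K : vset n) (r : R) : vset n := fun x => K x /\ vnorm x <= r.

Lemma ball_in_convex {n} (K : vset n) r : is_convex K -> is_convex (ball_in K r).
Proof.
  intros HK x y t [Kx Hx] [Ky Hy] Ht. split; [now apply HK|].
  eapply Rle_trans; [apply vnorm_add|]. rewrite !vnorm_scal, !Rabs_pos_eq by lra.
  nra.
Qed.

Lemma VI_localize {n} (G : Vec n -> Vec n) K r x :
  is_convex K -> vnorm x < r -> VI G (ball_in K r) x -> VI G K x.
Proof.
  intros HK Hr [[Kx _] Hx]. split; [exact Kx|]. intros y Ky.
  destruct (small_scale (vnorm (vsub y x)) (r - vnorm x)) as [t [Ht Htr]];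
    [apply vnorm_ge0 | lra |].
  set (z := vadd (vscal t y) (vscal (1 - t) x)).
  assert (Ez : vsub z x = vscal t (vsub y x)) by (unfold z; vec_eq).
  assert (Hz : ball_in K r z).
  { split; [apply HK; [assumption..|lra]|].
    pose proof (vnorm_le_sub z x) as H.
    rewrite Ez, vnorm_scal, Rabs_pos_eq in H by lra. lra. }
  specialize (Hx z Hz). rewrite Ez, dot_scal_r in Hx. nra.
Qed.

Lemma is_closed_ball_in {n} (K : vset n) r : is_closed K -> is_closed (ball_in K r).
Proof.
  intros HK x Hx. destruct (classic (K x)) as [Kx|Kx].
  - assert (Hr : r < vnorm x) by (apply Rnot_le_lt; intro; now apply Hx).
    exists (vnorm x - r). split; [lra|]. intros y Hy [_ H].
    pose proof (vnorm_le_sub x y). rewrite vnorm_sub_sym in Hy. lra.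
  - destruct (HK x Kx) as [e [He H]]. exists e. split; [exact He|].
    intros y Hy [Ky _]. exact (H y Hy Ky).
Qed.

(* Failing the conclusion, the alternative gives weights [xi], and monotonicity
   contradicts them at the barycentre [x = sum_i xi_i y_i], because
   [sum_i xi_i <G x, y_i - x> = 0]. *)
Lemma Minty_finite {n} (G : Vec n -> Vec n) K k (y : nat -> Vec n) eps :
  (exists x, K x) -> is_convex K -> monotone_on K G -> eps > 0 ->
  (forall i, (i < k)%nat -> K (y i)) ->
  exists x, K x /\ forall i, (i < k)%nat -> - eps < dot (G (y i)) (vsub (y i) x).
Proof.
  intros Hne HK Hm He Hy. apply NNPP; intro Hno.
  destruct (convex_alternative k K
    (fun i x => dot (G (y i)) (vsub (y i) x) + eps) Hne HK) as [xi [Hxi Hle]].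
  { intros i _ u v t. rewrite !dot_sub_r, dot_add_r, !dot_scal_r. ring. }
  { intros x Kx H. apply Hno. exists x. split; [exact Kx|].
    intros i Hi. specialize (H i Hi). lra. }
  set (x := vsum (fun i => vscal (xi i) (y i)) k).
  assert (Kx : K x) by now apply convex_vsum.
  specialize (Hle x Kx). destruct Hxi as [Hxi Hsum].
  assert (H : sumR (fun i => xi i * (dot (G x) (y i) - dot (G x) x + eps)) k <= 0).
  { eapply Rle_trans; [apply sumR_le|exact Hle]. intros i Hi.
    apply Rmult_le_compat_l; [now apply Hxi|].
    specialize (Hm x (y i) Kx (Hy i Hi)).
    rewrite dot_sub_l, !dot_sub_r in Hm. rewrite dot_sub_r. lra. }
  assert (Ex : sumR (fun i => xi i * dot (G x) (y i)) k = dot (G x) x).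
  { rewrite dot_comm. unfold x at 2. rewrite dot_vsum_l. apply sumR_ext.
    intros. rewrite dot_scal_l, dot_comm. reflexivity. }
  rewrite (sumR_ext _ (fun i => 1 * (xi i * dot (G x) (y i))
    + (eps - dot (G x) x) * xi i)) in H by (intros; ring).
  rewrite sumR_lin, Ex, Hsum in H. lra.
Qed.

Lemma VI_exists {n} (G : Vec n -> Vec n) K M :
  (exists x, K x) -> is_closed K -> is_convex K -> (forall x, K x -> vnorm x <= M) ->
  continuous_on K G -> monotone_on K G -> exists x, VI G K x.
Proof.
  intros Hne Hcl HK HM Hc Hm.
  assert (H : forall N, exists x, K x /\ forall y, K y -> exists z, K z /\
    vnorm (vsub y z) < / (INR N + 1) /\ - / (INR N + 1) < dot (G z) (vsub z x)).
  { intros N.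
    destruct (bounded_finite_net K M _ HM (inv_INR_pos N)) as [l [Hl Hnet]].
    destruct Hne as [x0 K0].
    destruct (Minty_finite G K (length l) (fun i => nth i l x0) _
      (ex_intro _ x0 K0) HK Hm (inv_INR_pos N)) as [x [Kx Hx]].
    { intros i Hi. now apply Hl, nth_In. }
    exists x. split; [exact Kx|]. intros y Ky.
    destruct (Hnet y Ky) as [z [Hz Hyz]].
    destruct (In_nth l z x0 Hz) as [i [Hi <-]].
    exists (nth i l x0). auto. }
  apply functional_choice in H. destruct H as [u Hu].
  destruct (bounded_cluster u M) as [x Hx].
  { intros k. apply HM, Hu. }
  exists x. apply Minty_VI; try assumption. split.
  { apply (closed_cluster K u x Hcl); [apply Hu | exact Hx]. }
  intros y Ky. apply (dot_cluster_ge0 u x (G y) y Hx). intros eps He.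
  assert (HM0 : 0 <= M) by (pose proof (vnorm_ge0 y); specialize (HM y Ky); lra).
  pose proof (vnorm_ge0 (G y)) as HG.
  destruct (small_scale (2 * M) (eps / 2)) as [e [[He0 _] Hee]]; [lra|lra|].
  destruct (Hc y Ky e He0) as [d [Hd Hcd]].
  destruct (small_scale (vnorm (G y) + 1) (eps / 2)) as [c [[Hc0 _] Hcc]]; [lra|lra|].
  destruct (inv_INR_small (Rmin d c)) as [N HN]; [now apply Rmin_glb_lt|].
  exists N. intros k Hk. destruct (Hu k) as [Kk Hk'].
  destruct (Hk' y Ky) as (z & Kz & Hyz & Hz).
  specialize (HN k Hk). pose proof (Rmin_l d c). pose proof (Rmin_r d c).
  assert (Hzy : vnorm (vsub (G z) (G y)) < e).
  { apply Hcd; [exact Kz|]. rewrite vnorm_sub_sym. lra. }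
  assert (E : dot (G y) (vsub y (u k)) = dot (G z) (vsub z (u k))
    - dot (vsub (G z) (G y)) (vsub z (u k)) + dot (G y) (vsub y z)).
  { rewrite dot_sub_l, !dot_sub_r. ring. }
  pose proof (dot_le (vsub (G z) (G y)) (vsub z (u k))) as H1.
  pose proof (Rabs_dot_le (G y) (vsub y z)) as H2. apply Rabs_le_inv in H2.
  pose proof (vnorm_sub_le z (u k)). pose proof (HM z Kz). pose proof (HM _ Kk).
  pose proof (vnorm_ge0 (vsub z (u k))). pose proof (vnorm_ge0 (vsub (G z) (G y))).
  assert (vnorm (vsub (G z) (G y)) * vnorm (vsub z (u k)) <= e * (2 * M))
    by (apply Rmult_le_compat; lra).
  assert (vnorm (G y) * vnorm (vsub y z) <= vnorm (G y) * c)
    by (apply Rmult_le_compat_l; lra).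
  nra.
Qed.

Lemma interval_clopen (P : R -> Prop) :
  P 0 ->
  (forall t, 0 <= t <= 1 -> P t -> exists d, d > 0 /\
    forall s, 0 <= s <= 1 -> Rabs (s - t) < d -> P s) ->
  (forall t, 0 <= t <= 1 -> ~ P t -> exists d, d > 0 /\
    forall s, 0 <= s <= 1 -> Rabs (s - t) < d -> ~ P s) ->
  P 1.
Proof.
  intros H0 Hop Hcl.
  set (E s := 0 <= s <= 1 /\ forall r, 0 <= r <= s -> P r).
  assert (E0 : E 0).
  { split; [lra|]. intros r Hr. now replace r with 0 by lra. }
  destruct (completeness E) as [c [Hub Hlub]].
  { exists 1. intros s [Hs _]. lra. }
  { now exists 0. }
  assert (Hc : 0 <= c <= 1).
  { split; [now apply Hub|]. apply Hlub. intros s [Hs _]. lra. }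
  assert (Hbelow : forall r, 0 <= r < c -> P r).
  { intros r Hr. apply NNPP; intro Hn.
    enough (c <= r) by lra. apply Hlub. intros s [_ Hs].
    apply Rnot_lt_le; intro. apply Hn, Hs. lra. }
  assert (Pc : P c).
  { apply NNPP; intro Hn. destruct (Hcl c Hc Hn) as [d [Hd H]].
    assert (c <> 0) by congruence.
    apply (H (Rmax 0 (c - d / 2))).
    - split; [apply Rmax_l | apply Rmax_lub; lra].
    - unfold Rmax; destruct Rle_dec; apply Rabs_def1; lra.
    - apply Hbelow. unfold Rmax; destruct Rle_dec; lra. }
  destruct (Hop c Hc Pc) as [d [Hd H]].
  assert (Hup : forall r, 0 <= r <= 1 -> r < c + d -> P r).
  { intros r Hr Hrd. destruct (Rlt_le_dec r c); [apply Hbelow; lra|].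
    apply H; [exact Hr|]. apply Rabs_def1; lra. }
  destruct (Rlt_le_dec 1 (c + d)) as [|Hle]; [apply Hup; lra|].
  enough (c + d / 2 <= c) by lra. apply Hub. split; [lra|].
  intros r Hr. apply Hup; lra.
Qed.

(** * Homotopy between scalarizations *)

Definition mix (xi0 xi1 : nat -> R) (t : R) (i : nat) : R :=
  t * xi1 i + (1 - t) * xi0 i.

Lemma weights_mix xi0 xi1 k t :
  weights xi0 k -> weights xi1 k -> 0 <= t <= 1 -> weights (mix xi0 xi1 t) k.
Proof.
  intros [H0 S0] [H1 S1] Ht. split.
  - intros i Hi. specialize (H0 i Hi). specialize (H1 i Hi). unfold mix. nra.
  - unfold mix. rewrite sumR_lin, S0, S1. ring.
Qed.

Lemma dot_comb_mix {n} (G : nat -> Vec n -> Vec n) xi0 xi1 k t x u :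
  dot (comb G (mix xi0 xi1 t) k x) u =
  t * dot (comb G xi1 k x) u + (1 - t) * dot (comb G xi0 k x) u.
Proof.
  rewrite !dot_comb_l, <- sumR_lin. apply sumR_ext. intros. unfold mix. ring.
Qed.

Definition scalarized_solutions {n} (G : nat -> Vec n -> Vec n) (m : nat)
  (K : vset n) : vset n :=
  fun x => exists xi, weights xi m /\ VI (comb G xi m) K x.

Definition rel_open {n} (S A : vset n) : Prop :=
  forall a, A a -> exists e, e > 0 /\
    forall p, S p -> vnorm (vsub p a) < e -> A p.

Definition clopen_in {n} (S A : vset n) : Prop :=
  subset A S /\ rel_open S A /\ rel_open S (fun x => S x /\ ~ A x).

Lemma clopen_in_convex {n} (S A V : vset n) x y :
  clopen_in S A -> is_convex V -> subset V S -> A x -> V x -> V y -> A y.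
Proof.
  intros (_ & Hop & Hcl) HV HVS Ax Vx Vy.
  set (z t := vadd (vscal t y) (vscal (1 - t) x)).
  assert (Vz : forall t, 0 <= t <= 1 -> V (z t)) by (intros; now apply HV).
  assert (Hz : forall e, e > 0 -> exists d, d > 0 /\
    forall s t, Rabs (s - t) < d -> vnorm (vsub (z s) (z t)) < e).
  { intros e He. pose proof (vnorm_ge0 (vsub y x)) as Hyx.
    destruct (small_scale _ e Hyx He) as [d [[Hd _] Hde]].
    exists d. split; [exact Hd|]. intros s t Hst.
    replace (vsub (z s) (z t)) with (vscal (s - t) (vsub y x)) by (unfold z; vec_eq).
    rewrite vnorm_scal. eapply Rle_lt_trans; [|exact Hde].
    apply Rmult_le_compat_r; [exact Hyx | lra]. }
  replace y with (z 1) by (unfold z; vec_eq).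
  apply (interval_clopen (fun t => A (z t))).
  - now replace (z 0) with x by (unfold z; vec_eq).
  - intros t _ At. destruct (Hop _ At) as [e [He H]].
    destruct (Hz e He) as [d [Hd Hdz]].
    exists d. split; [exact Hd|]. intros s Hs Hst. apply H; auto.
  - intros t Ht Ant. destruct (Hcl (z t) (conj (HVS _ (Vz t Ht)) Ant)) as [e [He H]].
    destruct (Hz e He) as [d [Hd Hdz]].
    exists d. split; [exact Hd|]. intros s Hs Hst. apply H; auto.
Qed.

Section Homotopy.
Context {n : nat} (m : nat) (K : vset n) (G : nat -> Vec n -> Vec n).
Context (HKcl : is_closed K) (HKcv : is_convex K).
Context (HGc : forall i, (i < m)%nat -> continuous_on K (G i)).
Context (HGm : forall i, (i < m)%nat -> monotone_on K (G i)).

Lemma VI_mix_cluster xi0 xi1 M (K' : vset n) (s : nat -> R) t (u : nat -> Vec n) x :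
  weights xi0 m -> weights xi1 m -> subset K' K -> is_closed K' -> is_convex K' ->
  0 <= t <= 1 -> (forall k, 0 <= s k <= 1) ->
  (forall k, Rabs (s k - t) < / (INR k + 1)) ->
  (forall k, vnorm (u k) <= M) ->
  (forall k, VI (comb G (mix xi0 xi1 (s k)) m) K' (u k)) ->
  cluster u x -> VI (comb G (mix xi0 xi1 t) m) K' x.
Proof.
  intros W0 W1 HK'K Hcl Hcv Ht Hs Hst HM Hu Hx.
  assert (HGc' : forall i, (i < m)%nat -> continuous_on K' (G i)).
  { intros i Hi y Ky eps He. destruct (HGc i Hi y (HK'K y Ky) eps He) as [d [Hd H]].
    exists d. split; [exact Hd|]. intros z Kz. apply H, HK'K, Kz. }
  assert (HGm' : forall i, (i < m)%nat -> monotone_on K' (G i)).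
  { intros i Hi y z Ky Kz. apply HGm; auto. }
  apply Minty_VI; [exact Hcv | now apply continuous_on_comb |]. split.
  { apply (closed_cluster K' u x Hcl); [apply Hu | exact Hx]. }
  intros y Ky. apply (dot_cluster_ge0 u x _ y Hx). intros eps He.
  set (B := (vnorm (comb G xi1 m y) + vnorm (comb G xi0 m y)) * (vnorm y + M)).
  pose proof (vnorm_ge0 (comb G xi1 m y)) as HG1.
  pose proof (vnorm_ge0 (comb G xi0 m y)) as HG0.
  assert (HB : 0 <= B).
  { pose proof (vnorm_ge0 y). pose proof (vnorm_ge0 (u 0%nat)). specialize (HM 0%nat).
    apply Rmult_le_pos; lra. }
  destruct (small_scale B eps HB He) as [d [[Hd _] HdB]].
  destruct (inv_INR_small d Hd) as [N HN]. exists N. intros k Hk.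
  destruct (VI_Minty _ _ _ (monotone_on_comb K' G _ m
    (weights_mix _ _ _ _ W0 W1 (Hs k)) HGm') (Hu k)) as [_ Hmin].
  specialize (Hmin y Ky). specialize (HN k Hk). specialize (Hst k).
  rewrite dot_comb_mix in Hmin |- *.
  pose proof (Rabs_dot_le (comb G xi1 m y) (vsub y (u k))) as H1.
  pose proof (Rabs_dot_le (comb G xi0 m y) (vsub y (u k))) as H0.
  pose proof (vnorm_sub_le y (u k)) as Hyu. specialize (HM k).
  set (p := dot (comb G xi1 m y) (vsub y (u k))) in *.
  set (q := dot (comb G xi0 m y) (vsub y (u k))) in *.
  assert (Hpq : Rabs (p - q) <= B).
  { eapply Rle_trans; [apply Rabs_triang|]. rewrite Rabs_Ropp. unfold B.
    pose proof (vnorm_ge0 (vsub y (u k))). nra. }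
  assert (Hprod : Rabs ((s k - t) * (p - q)) <= d * B).
  { rewrite Rabs_mult. apply Rmult_le_compat; try apply Rabs_pos; lra. }
  apply Rabs_le_inv in Hprod. lra.
Qed.

Lemma scalarized_mix xi0 xi1 t x :
  weights xi0 m -> weights xi1 m -> 0 <= t <= 1 ->
  VI (comb G (mix xi0 xi1 t) m) K x -> scalarized_solutions G m K x.
Proof. intros. exists (mix xi0 xi1 t). split; [now apply weights_mix | assumption]. Qed.

(* If [s k -> t] and the problems at [s k] had no solution in [A], solutions of
   the problems truncated to a large ball would accumulate at a truncated
   solution [x] for [t]. Averaging [x] with a true solution in [A], which lies
   well inside the ball, shows that [x] is itself interior, hence in [A]. *)
Lemma mix_solution_open A xi0 xi1 M t :
  clopen_in (scalarized_solutions G m K) A -> (forall x, A x -> vnorm x <= M) ->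
  weights xi0 m -> weights xi1 m -> 0 <= t <= 1 ->
  (exists x, A x /\ VI (comb G (mix xi0 xi1 t) m) K x) ->
  exists d, d > 0 /\ forall s, 0 <= s <= 1 -> Rabs (s - t) < d ->
    exists x, A x /\ VI (comb G (mix xi0 xi1 s) m) K x.
Proof.
  intros HA HM W0 W1 Ht [a [Aa Ha]]. apply NNPP; intro Hno.
  assert (Hseq : forall k, exists s, (0 <= s <= 1 /\ Rabs (s - t) < / (INR k + 1)) /\
    ~ exists x, A x /\ VI (comb G (mix xi0 xi1 s) m) K x).
  { intros k. apply NNPP; intro H. apply Hno. exists (/ (INR k + 1)).
    split; [apply inv_INR_pos|]. intros s Hs Hst. apply NNPP; intro H'.
    apply H. exists s. tauto. }
  apply functional_choice in Hseq. destruct Hseq as [s Hs].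
  assert (HM0 : 0 <= M) by (pose proof (vnorm_ge0 a); specialize (HM a Aa); lra).
  set (r := 3 * M + 1).
  assert (HGc' : forall i, (i < m)%nat -> continuous_on (ball_in K r) (G i)).
  { intros i Hi y [Ky _] eps He. destruct (HGc i Hi y Ky eps He) as [d [Hd H]].
    exists d. split; [exact Hd|]. intros z [Kz _]. now apply H. }
  assert (HGm' : forall i, (i < m)%nat -> monotone_on (ball_in K r) (G i)).
  { intros i Hi y z [Ky _] [Kz _]. now apply HGm. }
  assert (Hcv : is_convex (ball_in K r)) by now apply ball_in_convex.
  assert (Hcl : is_closed (ball_in K r)) by now apply is_closed_ball_in.
  assert (Wm : forall s, 0 <= s <= 1 -> weights (mix xi0 xi1 s) m)
    by (intros; now apply weights_mix).
  assert (Har : ball_in K r a).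
  { split; [apply Ha|]. specialize (HM a Aa). unfold r. lra. }
  assert (Hu : forall k, exists x, VI (comb G (mix xi0 xi1 (s k)) m) (ball_in K r) x).
  { intros k. apply VI_exists with r; try assumption.
    - now exists a.
    - intros x [_ Hx]; exact Hx.
    - now apply continuous_on_comb.
    - apply monotone_on_comb; [apply Wm, Hs | exact HGm']. }
  apply functional_choice in Hu. destruct Hu as [u Hu].
  destruct (bounded_cluster u r) as [x Hx]; [intros k; apply (Hu k)|].
  assert (Hxt : VI (comb G (mix xi0 xi1 t) m) (ball_in K r) x).
  { apply (VI_mix_cluster xi0 xi1 r (ball_in K r) s t u x); try assumption;
      try (intros k; apply Hs).
    - intros y [Ky _]; exact Ky.
    - intros k; apply (Hu k). }
  assert (HVA : forall y, VI (comb G (mix xi0 xi1 t) m) K y -> A y).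
  { intros y Hy. apply (clopen_in_convex _ A _ a y HA
      (VI_convex (comb G (mix xi0 xi1 t) m) K HKcv
        (continuous_on_comb K G _ m HGc)
        (monotone_on_comb K G _ m (Wm t Ht) HGm))); try assumption.
    intros z Hz. now apply scalarized_mix with xi0 xi1 t. }
  assert (Hat : VI (comb G (mix xi0 xi1 t) m) (ball_in K r) a).
  { split; [exact Har|]. intros y [Ky _]. now apply Ha. }
  assert (Hxr : vnorm x < r).
  { pose proof (HM a Aa) as HMa. destruct Hxt as [[Kx Hxr] Hxt].
    apply Rnot_le_lt; intro Hge.
    set (z := vadd (vscal (/ 2) x) (vscal (1 - / 2) a)).
    assert (Hz : VI (comb G (mix xi0 xi1 t) m) (ball_in K r) z).
    { apply VI_convex; try assumption.
      - now apply continuous_on_comb.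
      - apply monotone_on_comb; [now apply Wm | exact HGm'].
      - now split.
      - lra. }
    assert (Hzr : vnorm z < r).
    { eapply Rle_lt_trans; [apply vnorm_add|].
      rewrite !vnorm_scal, !Rabs_pos_eq by lra. unfold r in *. lra. }
    pose proof (HM z (HVA z (VI_localize _ _ _ _ HKcv Hzr Hz))) as HMz.
    assert (Hx2 : vnorm x <= 2 * vnorm z + vnorm a).
    { replace x with (vsub (vscal 2 z) a) by (unfold z; vec_eq; field).
      eapply Rle_trans; [apply vnorm_sub_le|].
      rewrite vnorm_scal, Rabs_pos_eq by lra. lra. }
    unfold r in *. lra. }
  assert (Ax : A x) by (apply HVA; now apply VI_localize with r).
  destruct HA as (_ & Hop & _). destruct (Hop x Ax) as [e [He Hball]].
  destruct (Hx (Rmin e (r - vnorm x)) 0%nat) as [k [_ Hk]].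
  { apply Rmin_glb_lt; lra. }
  pose proof (Rmin_l e (r - vnorm x)). pose proof (Rmin_r e (r - vnorm x)).
  destruct (Hs k) as [[Hsk _] Hnk]. apply Hnk. exists (u k).
  assert (Hk' : VI (comb G (mix xi0 xi1 (s k)) m) K (u k)).
  { apply VI_localize with r; [exact HKcv| |apply Hu].
    pose proof (vnorm_le_sub (u k) x). lra. }
  split; [|exact Hk']. apply Hball; [|lra].
  now apply scalarized_mix with xi0 xi1 (s k).
Qed.

Lemma mix_solution_closed A xi0 xi1 M t :
  clopen_in (scalarized_solutions G m K) A -> (forall x, A x -> vnorm x <= M) ->
  weights xi0 m -> weights xi1 m -> 0 <= t <= 1 ->
  (~ exists x, A x /\ VI (comb G (mix xi0 xi1 t) m) K x) ->
  exists d, d > 0 /\ forall s, 0 <= s <= 1 -> Rabs (s - t) < d ->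
    ~ exists x, A x /\ VI (comb G (mix xi0 xi1 s) m) K x.
Proof.
  intros (HAS & _ & Hcl) HM W0 W1 Ht Hn. apply NNPP; intro Hno.
  assert (Hseq : forall k, exists s, (0 <= s <= 1 /\ Rabs (s - t) < / (INR k + 1)) /\
    exists x, A x /\ VI (comb G (mix xi0 xi1 s) m) K x).
  { intros k. apply NNPP; intro H. apply Hno. exists (/ (INR k + 1)).
    split; [apply inv_INR_pos|]. intros s Hs Hst H'.
    apply H. exists s. tauto. }
  apply functional_choice in Hseq. destruct Hseq as [s Hs].
  assert (Hu := fun k => proj2 (Hs k)).
  apply functional_choice in Hu. destruct Hu as [u Hu].
  destruct (bounded_cluster u M) as [x Hx]; [intros k; apply HM, Hu|].
  assert (Hxt : VI (comb G (mix xi0 xi1 t) m) K x).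
  { apply (VI_mix_cluster xi0 xi1 M K s t u x); try assumption;
      try (intros k; apply Hs); try (intros k; apply Hu).
    - now intros y.
    - intros k; apply HM, Hu. }
  apply Hn. exists x. split; [|exact Hxt]. apply NNPP; intro Anx.
  destruct (Hcl x) as [e [He Hball]].
  { split; [now apply scalarized_mix with xi0 xi1 t | exact Anx]. }
  destruct (Hx e 0%nat He) as [k [_ Hk]].
  destruct (Hball (u k)) as [_ HAk]; [apply HAS, Hu | exact Hk | apply HAk, Hu].
Qed.

Lemma bounded_clopen_full A :
  clopen_in (scalarized_solutions G m K) A -> is_bounded A -> (exists a, A a) ->
  subset (scalarized_solutions G m K) A.
Proof.
  intros HA [M HM] [a Aa] y Hy.
  assert (Ha := proj1 HA a Aa).
  destruct Ha as [xi0 [W0 Ha]], Hy as [xi1 [W1 Hy]].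
  assert (H1 : exists x, A x /\ VI (comb G (mix xi0 xi1 1) m) K x).
  { apply (interval_clopen (fun t => exists x, A x /\ VI (comb G (mix xi0 xi1 t) m) K x)).
    - exists a. split; [exact Aa|].
      replace (mix xi0 xi1 0) with xi0; [exact Ha|].
      apply functional_extensionality; intro; unfold mix; ring.
    - intros; now apply mix_solution_open with M.
    - intros; now apply mix_solution_closed with M. }
  replace (mix xi0 xi1 1) with xi1 in H1
    by (apply functional_extensionality; intro; unfold mix; ring).
  destruct H1 as [x [Ax Hx]].
  apply (clopen_in_convex _ A (VI (comb G xi1 m) K) x y HA); try assumption.
  - apply VI_convex; [exact HKcv | now apply continuous_on_comb |
      now apply monotone_on_comb].
  - intros z Hz. now exists xi1.
Qed.

End Homotopy.

(** * Weak Pareto solutions and their components *)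

Definition Fseq {n m} (F : Idx m -> Vec n -> Vec n) (i : nat) : Vec n -> Vec n :=
  match Compare_dec.lt_dec i m with
  | left h => F (exist _ i h)
  | right _ => fun _ _ => 0
  end.

Lemma Fseq_in {n m} (F : Idx m -> Vec n -> Vec n) i (h : (i < m)%nat) :
  Fseq F i = F (exist _ i h).
Proof.
  unfold Fseq. destruct Compare_dec.lt_dec as [h'|]; [|lia].
  now rewrite (proof_irrelevance _ h' h).
Qed.

(* Importing [Lra] shadows [Fapp]. *)
Lemma in_int_Fapp {n m} (F : Idx m -> Vec n -> Vec n) (x u : Vec n) :
  in_int_Rplus (Defs.Fapp F x u) <-> forall i, (i < m)%nat -> dot (Fseq F i x) u > 0.
Proof.
  split.
  - intros H i Hi. rewrite (Fseq_in F i Hi). apply H.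
  - intros H [i Hi]. unfold Defs.Fapp. rewrite <- (Fseq_in F i Hi). now apply H.
Qed.

Lemma Solw_scalarized {n m} (F : Idx m -> Vec n -> Vec n) K :
  is_convex K -> forall x, Solw F K x <-> scalarized_solutions (Fseq F) m K x.
Proof.
  intros HK x. split.
  - intros [Kx Hx].
    destruct (convex_alternative m K (fun i y => dot (Fseq F i x) (vsub x y)))
      as [xi [W Hxi]]; try assumption.
    + now exists x.
    + intros i _ y z t. rewrite !dot_sub_r, dot_add_r, !dot_scal_r. ring.
    + intros y Ky H. apply (Hx y Ky). now apply in_int_Fapp.
    + exists xi. split; [exact W|]. split; [exact Kx|]. intros y Ky.
      specialize (Hxi y Ky). rewrite <- dot_comb_l in Hxi.
      rewrite dot_sub_r in *. lra.
  - intros [xi [[Hxi Hsum] [Kx Hx]]]. split; [exact Kx|]. intros y Ky H.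
    rewrite in_int_Fapp in H. specialize (Hx y Ky).
    assert (Hle : sumR (fun i => xi i * dot (Fseq F i x) (vsub x y)) m <= 0)
      by (rewrite <- dot_comb_l; rewrite dot_sub_r in *; lra).
    assert (Hpos : forall i, (i < m)%nat -> 0 <= xi i * dot (Fseq F i x) (vsub x y)).
    { intros i Hi. specialize (H i Hi). specialize (Hxi i Hi). nra. }
    enough (sumR xi m = INR m * 0) by lra. rewrite <- sumR_const.
    apply sumR_ext. intros i Hi.
    pose proof (sumR_term_le (fun i => xi i * dot (Fseq F i x) (vsub x y)) m i Hpos Hi) as Hle'.
    simpl in Hle'. specialize (H i Hi). specialize (Hxi i Hi). nra.
Qed.

Lemma continuous_on_dot_pos {n} (K : vset n) (f : Vec n -> Vec n) x y :
  continuous_on K f -> K x -> dot (f x) (vsub x y) > 0 ->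
  exists d, d > 0 /\
    forall z, K z -> vnorm (vsub z x) < d -> dot (f z) (vsub z y) > 0.
Proof.
  intros Hf Kx Hpos. set (B := dot (f x) (vsub x y)) in *.
  pose proof (vnorm_ge0 (f x)) as H1. pose proof (vnorm_ge0 (vsub x y)) as H2.
  destruct (small_scale (vnorm (vsub x y) + 1) (B / 2)) as [e [[He _] HeB]]; [lra|lra|].
  destruct (small_scale (vnorm (f x)) (B / 2)) as [c [Hc HcB]]; [lra|lra|].
  destruct (Hf x Kx e He) as [d [Hd Hfd]].
  exists (Rmin d c). split; [apply Rmin_glb_lt; lra|]. intros z Kz Hz.
  pose proof (Rmin_l d c). pose proof (Rmin_r d c).
  specialize (Hfd z Kz ltac:(lra)).
  pose proof (Rabs_dot_le (vsub (f z) (f x)) (vsub z y)) as H3.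
  pose proof (Rabs_dot_le (f x) (vsub z x)) as H4.
  apply Rabs_le_inv in H3. apply Rabs_le_inv in H4.
  pose proof (vnorm_sub_triangle z x y) as H5.
  assert (E : dot (f z) (vsub z y) =
    B + dot (vsub (f z) (f x)) (vsub z y) + dot (f x) (vsub z x)).
  { unfold B. rewrite dot_sub_l, !dot_sub_r. ring. }
  assert (vnorm (vsub (f z) (f x)) * vnorm (vsub z y)
    <= e * (vnorm (vsub x y) + 1)).
  { apply Rmult_le_compat; try apply vnorm_ge0; lra. }
  assert (vnorm (f x) * vnorm (vsub z x) <= vnorm (f x) * c)
    by (apply Rmult_le_compat_l; lra).
  lra.
Qed.

Lemma Solw_closed {n m} (F : Idx m -> Vec n -> Vec n) K :
  is_closed K -> (forall i, (i < m)%nat -> continuous_on K (Fseq F i)) ->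
  is_closed (Solw F K).
Proof.
  intros HK HF x Hx. destruct (classic (K x)) as [Kx|Kx].
  2: { destruct (HK x Kx) as [e [He H]]. exists e. split; [exact He|].
       intros y Hy [Ky _]. exact (H y Hy Ky). }
  assert (Hy : exists y, K y /\ in_int_Rplus (Defs.Fapp F x (vsub x y))).
  { apply NNPP; intro H. apply Hx. split; [exact Kx|]. intros y Ky Hy.
    apply H. now exists y. }
  destruct Hy as [y [Ky Hy]]. rewrite in_int_Fapp in Hy.
  assert (Hd : forall k, (k <= m)%nat -> exists d, d > 0 /\ forall z, K z ->
    vnorm (vsub z x) < d -> forall i, (i < k)%nat -> dot (Fseq F i z) (vsub z y) > 0).
  { induction k as [|k IH]; intros Hk.
    - exists 1. split; [lra|]. intros; lia.
    - destruct IH as [d1 [Hd1 H1]]; [lia|].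
      destruct (continuous_on_dot_pos K (Fseq F k) x y (HF k Hk) Kx (Hy k Hk))
        as [d2 [Hd2 H2]].
      exists (Rmin d1 d2). split; [now apply Rmin_glb_lt|]. intros z Kz Hz i Hi.
      pose proof (Rmin_l d1 d2). pose proof (Rmin_r d1 d2).
      destruct (Nat.eq_dec i k) as [->|].
      + apply H2; [exact Kz | lra].
      + apply H1; [exact Kz | lra | lia]. }
  destruct (Hd m (le_n m)) as [d [Hd0 H]]. exists d. split; [exact Hd0|].
  intros z Hz [Kz Hsol]. apply (Hsol y Ky), in_int_Fapp. now apply H.
Qed.

Inductive chain {n} (X : vset n) (e : R) (c : Vec n) : Vec n -> Prop :=
| chain_base : chain X e c c
| chain_step x y : chain X e c x -> X y -> vnorm (vsub y x) < e -> chain X e c y.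

Lemma chain_in {n} (X : vset n) e c x : X c -> chain X e c x -> X x.
Proof. intros Xc H. now destruct H. Qed.

Lemma chain_mono {n} (X : vset n) e e' c x : e <= e' -> chain X e c x -> chain X e' c x.
Proof.
  intros He H. induction H as [|x y H IH Xy Hxy]; [constructor|].
  apply (chain_step _ _ _ x); [exact IH | exact Xy | lra].
Qed.

Definition chain_component {n} (X : vset n) (c x : Vec n) : Prop :=
  X x /\ forall e, e > 0 -> chain X e c x.

Lemma chain_cluster {n} (X : vset n) c (u : nat -> Vec n) x :
  is_closed X -> X c -> (forall k, chain X (/ (INR k + 1)) c (u k)) ->
  cluster u x -> chain_component X c x.
Proof.
  intros HX Xc Hu Hx.
  assert (Xx : X x).
  { apply (closed_cluster X u x HX); [|exact Hx]. intros k. exact (chain_in _ _ _ _ Xc (Hu k)). }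
  split; [exact Xx|]. intros e He. destruct (inv_INR_small e He) as [N HN].
  destruct (Hx e N He) as [k [Hk1 Hk2]].
  apply (chain_step _ _ _ (u k)); [|exact Xx|now rewrite vnorm_sub_sym].
  apply chain_mono with (/ (INR k + 1)); [|apply Hu]. specialize (HN k Hk1). lra.
Qed.

Lemma chain_exit {n} (X P : vset n) e c x :
  chain X e c x -> P c -> ~ P x ->
  exists y z, P y /\ ~ P z /\ chain X e c z /\ vnorm (vsub z y) < e.
Proof.
  intros H Pc. induction H as [|x y H IH Xy Hxy]; intros Pn; [contradiction|].
  destruct (classic (P x)) as [Px|Px]; [|now apply IH].
  exists x, y. repeat split; try assumption. now apply chain_step with x.
Qed.

Definition thicken {n} (A : vset n) (d : R) : vset n :=
  fun x => exists a, A a /\ vnorm (vsub x a) < d.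

Lemma thicken_open {n} (A : vset n) d : is_open (thicken A d).
Proof.
  intros x [a [Aa Ha]]. exists (d - vnorm (vsub x a)). split; [lra|].
  intros y Hy. exists a. split; [exact Aa|].
  pose proof (vnorm_sub_triangle y x a). lra.
Qed.

Lemma compact_separation {n} (A B : vset n) M :
  (forall x, A x -> vnorm x <= M) ->
  (forall u x, (forall k, A (u k)) -> cluster u x -> A x) ->
  (forall u x, (forall k, B (u k)) -> cluster u x -> B x) ->
  (forall x, A x -> B x -> False) ->
  exists d, d > 0 /\ forall a b, A a -> B b -> d <= vnorm (vsub a b).
Proof.
  intros HM HA HB Hdisj. apply NNPP; intro Hno.
  assert (H : forall k, exists p, (A (fst p) /\ B (snd p)) /\
    vnorm (vsub (fst p) (snd p)) < / (INR k + 1)).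
  { intros k. apply NNPP; intro H. apply Hno. exists (/ (INR k + 1)).
    split; [apply inv_INR_pos|]. intros a b Aa Bb. apply Rnot_lt_le; intro Hlt.
    apply H. now exists (a, b). }
  apply functional_choice in H. destruct H as [p Hp].
  destruct (bounded_cluster (fun k => fst (p k)) M) as [x Hx].
  { intros k. apply HM, Hp. }
  apply (Hdisj x).
  - apply (HA (fun k => fst (p k))); [intros k; apply Hp | exact Hx].
  - apply (HB (fun k => snd (p k))); [intros k; apply Hp|].
    intros e N He. destruct (inv_INR_small (e / 2) ltac:(lra)) as [N' HN].
    destruct (Hx (e / 2) (N + N')%nat ltac:(lra)) as [k [Hk1 Hk2]].
    exists k. split; [lia|]. specialize (HN k ltac:(lia)). destruct (Hp k) as [_ Hpk].
    pose proof (vnorm_sub_triangle (snd (p k)) (fst (p k)) x) as Ht.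
    rewrite (vnorm_sub_sym (snd (p k)) (fst (p k))) in Ht. simpl in Hk2. lra.
Qed.

Lemma connected_from_point {n} (S : vset n) c :
  S c ->
  (forall U V : vset n, is_open U -> is_open V ->
    (forall x, S x -> U x \/ V x) -> (forall x, S x -> U x -> V x -> False) ->
    U c -> forall x, S x -> ~ V x) ->
  is_connected S.
Proof.
  intros Sc H (U & V & HU & HV & Hcov & [p [Sp Up]] & [q [Sq Vq]] & Hd).
  destruct (Hcov c Sc) as [Uc|Vc].
  - exact (H U V HU HV Hcov Hd Uc q Sq Vq).
  - apply (H V U HV HU) with p; try assumption.
    + intros x Sx. destruct (Hcov x Sx); auto.
    + intros x Sx Vx Ux. exact (Hd x Sx Ux Vx).
Qed.

(* If [U], [V] split the component, a fine chain from [c] to a point of [V] must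
   leave a thickening of the [U] part; the exit points accumulate at a point of
   the component lying in neither part. *)
Lemma chain_component_connected {n} (X : vset n) c :
  is_closed X -> is_bounded X -> X c -> is_connected (chain_component X c).
Proof.
  intros HX [M HM] Xc. set (Q := chain_component X c).
  assert (Qc : Q c) by (split; [exact Xc | constructor]).
  apply connected_from_point with c; [exact Qc|].
  intros U V HU HV Hcov Hdisj Uc q Qq Vq.
  assert (HQ : forall x, (forall e, e > 0 -> exists y, Q y /\ vnorm (vsub y x) < e) -> Q x).
  { intros x H. assert (Xx : X x).
    { apply NNPP; intro Hn. destruct (HX x Hn) as [e [He Hb]].
      destruct (H e He) as [y [[Xy _] Hy]]. exact (Hb y Hy Xy). }
    split; [exact Xx|]. intros e He. destruct (H e He) as [y [[_ Hy] Hyx]].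
    apply (chain_step _ _ _ y); [now apply Hy | exact Xx | now rewrite vnorm_sub_sym]. }
  assert (HQP : forall (P O : vset n), is_open O ->
    (forall x, Q x -> P x \/ O x) -> (forall x, Q x -> P x -> O x -> False) ->
    forall x, (forall e, e > 0 -> exists y, (Q y /\ P y) /\ vnorm (vsub y x) < e) ->
    Q x /\ P x).
  { intros P O HO Hc Hd x H.
    assert (Qx : Q x).
    { apply HQ. intros e He. destruct (H e He) as [y [[Qy _] Hy]]. now exists y. }
    split; [exact Qx|]. destruct (Hc x Qx) as [Px|Ox]; [exact Px|]. exfalso.
    destruct (HO x Ox) as [e [He Hb]]. destruct (H e He) as [y [[Qy Py] Hy]].
    exact (Hd y Qy Py (Hb y Hy)). }
  destruct (compact_separation (fun x => Q x /\ U x) (fun x => Q x /\ V x) M)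
    as [d [Hd Hsep]].
  { intros x [[Xx _] _]. now apply HM. }
  { intros u x Hu Hx. apply (HQP U V HV Hcov Hdisj). intros e He.
    destruct (Hx e 0%nat He) as [k [_ Hk]]. now exists (u k). }
  { intros v x Hv Hx. apply (HQP V U HU).
    - intros y Qy. destruct (Hcov y Qy); auto.
    - intros y Qy Vy Uy. exact (Hdisj y Qy Uy Vy).
    - intros e He. destruct (Hx e 0%nat He) as [k [_ Hk]]. now exists (v k). }
  { intros x [Qx Ux] [_ Vx]. exact (Hdisj x Qx Ux Vx). }
  set (TU := thicken (fun x => Q x /\ U x) (d / 3)).
  set (TV := thicken (fun x => Q x /\ V x) (d / 3)).
  assert (Hz : forall k, exists z, chain X (/ (INR k + 1)) c z /\ ~ TU z /\ ~ TV z).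
  { intros k. set (e := Rmin (/ (INR k + 1)) (d / 3)).
    assert (He : e > 0) by (apply Rmin_glb_lt; [apply inv_INR_pos | lra]).
    pose proof (Rmin_l (/ (INR k + 1)) (d / 3)) as Hel.
    pose proof (Rmin_r (/ (INR k + 1)) (d / 3)) as Her. fold e in Hel, Her.
    destruct (chain_exit X TU e c q) as (y & z & Ty & Tz & Hz & Hzy).
    - now apply Qq.
    - exists c. rewrite vnorm_sub_diag. split; [now split | lra].
    - intros [a [Aa Ha]]. pose proof (Hsep a q Aa (conj Qq Vq)).
      rewrite vnorm_sub_sym in Ha. lra.
    - exists z. split; [now apply chain_mono with e|]. split; [exact Tz|].
      destruct Ty as [a [Aa Ha]]. intros [b [Bb Hb]].
      pose proof (Hsep a b Aa Bb). pose proof (vnorm_sub_triangle a y b).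
      pose proof (vnorm_sub_triangle y z b).
      rewrite (vnorm_sub_sym a y), (vnorm_sub_sym y z) in *. lra. }
  apply functional_choice in Hz. destruct Hz as [u Hu].
  destruct (bounded_cluster u M) as [x Hx].
  { intros k. apply HM. apply (chain_in X (/ (INR k + 1)) c); [exact Xc | apply Hu]. }
  assert (Qx : Q x) by (apply chain_cluster with u; try assumption; apply Hu).
  assert (Hin : forall T : vset n, is_open T -> (forall k, ~ T (u k)) -> ~ T x).
  { intros T HT Hn Tx. destruct (HT x Tx) as [e [He Hb]].
    destruct (Hx e 0%nat He) as [k [_ Hk]]. exact (Hn k (Hb _ Hk)). }
  destruct (Hcov x Qx) as [Ux|Vx].
  - apply (Hin TU (thicken_open _ _)); [intros k; apply Hu|].
    exists x. rewrite vnorm_sub_diag. split; [now split | lra].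
  - apply (Hin TV (thicken_open _ _)); [intros k; apply Hu|].
    exists x. rewrite vnorm_sub_diag. split; [now split | lra].
Qed.

Lemma connected_union {n} (A B : vset n) c :
  is_connected A -> is_connected B -> A c -> B c ->
  is_connected (fun x => A x \/ B x).
Proof.
  intros HA HB Ac Bc. apply connected_from_point with c; [now left|].
  intros U V HU HV Hcov Hdisj Uc x [Ax|Bx] Vx.
  - apply HA. exists U, V. repeat split; try assumption; eauto.
  - apply HB. exists U, V. repeat split; try assumption; eauto.
Qed.

Lemma bounded_component_clopen {n} (S C : vset n) :
  is_closed S -> is_component S C -> is_bounded C ->
  exists A, clopen_in S A /\ is_bounded A /\ exists a, A a.
Proof.
  intros HS ([c Cc] & HCS & HCc & Hmax) [M HM].
  set (X := ball_in S (M + 1)).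
  assert (HX : is_closed X) by now apply is_closed_ball_in.
  assert (Xc : X c) by (split; [now apply HCS | specialize (HM c Cc); lra]).
  assert (HXb : is_bounded X) by (exists (M + 1); now intros x [_ Hx]).
  assert (HQC : subset (chain_component X c) C).
  { intros x Qx. apply (Hmax (fun x => C x \/ chain_component X c x)).
    - intros y; now left.
    - intros y [Cy|[[Sy _] _]]; [now apply HCS | exact Sy].
    - apply connected_union with c; [exact HCc | | exact Cc|].
      + now apply chain_component_connected.
      + split; [exact Xc | constructor].
    - now right. }
  assert (Hk : exists k, forall x, chain X (/ (INR k + 1)) c x -> vnorm x <= M + / 2).
  { apply NNPP; intro Hno.
    assert (H : forall k, exists x, chain X (/ (INR k + 1)) c x /\ M + / 2 < vnorm x).
    { intros k. apply NNPP; intro H. apply Hno. exists k. intros x Hx.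
      apply Rnot_lt_le; intro. apply H. now exists x. }
    apply functional_choice in H. destruct H as [u Hu].
    destruct (bounded_cluster u (M + 1)) as [x Hx].
    { intros k. exact (proj2 (chain_in X _ c _ Xc (proj1 (Hu k)))). }
    assert (Qx : chain_component X c x)
      by (apply chain_cluster with u; try assumption; apply Hu).
    specialize (HM x (HQC x Qx)). destruct (Hx (/ 2) 0%nat ltac:(lra)) as [k [_ Hk]].
    destruct (Hu k) as [_ Huk]. pose proof (vnorm_le_sub (u k) x). lra. }
  destruct Hk as [k Hk]. set (e := / (INR k + 1)) in *.
  assert (He : e > 0) by apply inv_INR_pos.
  exists (chain X e c). repeat split.
  - intros x Hx. exact (proj1 (chain_in X e c x Xc Hx)).
  - intros a Ha. exists (Rmin e (/ 2)). split; [apply Rmin_glb_lt; lra|].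
    intros p Sp Hp. pose proof (Rmin_l e (/ 2)). pose proof (Rmin_r e (/ 2)).
    apply (chain_step X e c a); [exact Ha | | lra].
    split; [exact Sp|]. pose proof (vnorm_le_sub p a). specialize (Hk a Ha). lra.
  - intros a [Sa Ha]. exists (Rmin e (/ 2)). split; [apply Rmin_glb_lt; lra|].
    intros p Sp Hp. pose proof (Rmin_l e (/ 2)). pose proof (Rmin_r e (/ 2)).
    split; [exact Sp|]. intro Hch. apply Ha. rewrite vnorm_sub_sym in Hp.
    apply (chain_step X e c p); [exact Hch | | lra].
    split; [exact Sa|]. pose proof (vnorm_le_sub a p). specialize (Hk p Hch). lra.
  - exists (M + / 2). exact Hk.
  - exists c. constructor.
Qed.

Lemma clopen_of_separation {n} (S U V : vset n) :
  is_open U -> is_open V -> (forall x, S x -> U x \/ V x) ->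
  (forall x, S x -> U x -> V x -> False) -> clopen_in S (fun x => S x /\ U x).
Proof.
  intros HU HV Hcov Hdisj. repeat split.
  - now intros x [Sx _].
  - intros a [_ Ua]. destruct (HU a Ua) as [e [He H]]. exists e. auto.
  - intros a [Sa Ha]. destruct (Hcov a Sa) as [Ua|Va]; [tauto|].
    destruct (HV a Va) as [e [He H]]. exists e. split; [exact He|].
    intros p Sp Hp. split; [exact Sp|]. intros [_ Up]. eauto.
Qed.

Lemma clopen_in_ext {n} (S S' A : vset n) :
  (forall x, S x <-> S' x) -> clopen_in S A -> clopen_in S' A.
Proof.
  intros H (HAS & Hop & Hcl). split; [|split].
  - intros x Ax. now apply H, HAS.
  - intros a Aa. destruct (Hop a Aa) as [e [He Hb]]. exists e. split; [exact He|].
    intros p Sp. now apply Hb, H.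
  - intros a [Sa Aa]. destruct (Hcl a (conj (proj2 (H a) Sa) Aa)) as [e [He Hb]].
    exists e. split; [exact He|]. intros p Sp Hp. split; [exact Sp|].
    apply (Hb p); [now apply H | exact Hp].
Qed.

Theorem theorem2 (n m : nat) (K : vset n) (F : Idx m -> Vec n -> Vec n)
  (HKne : exists x, K x) (HKcl : is_closed K) (HKcv : is_convex K)
  (HFc : forall l, continuous_on K (F l))
  (Hmono : monotone_VVI F K)
  (Hdisc : ~ is_connected (Solw F K)) :
  forall C, is_component (Solw F K) C -> ~ is_bounded C.
Proof.
  intros C HC HCb.
  assert (HGc : forall i, (i < m)%nat -> continuous_on K (Fseq F i)).
  { intros i Hi. rewrite (Fseq_in F i Hi). apply HFc. }
  assert (HGm : forall i, (i < m)%nat -> monotone_on K (Fseq F i)).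
  { intros i Hi. rewrite (Fseq_in F i Hi). intros x y Kx Ky. now apply Rge_le, Hmono. }
  assert (Hfull : forall A, clopen_in (Solw F K) A -> is_bounded A ->
    (exists a, A a) -> subset (Solw F K) A).
  { intros A HA HAb HAne x Hx.
    apply (bounded_clopen_full m K (Fseq F)); try assumption.
    - apply clopen_in_ext with (Solw F K); [now apply Solw_scalarized | exact HA].
    - now apply Solw_scalarized. }
  destruct (bounded_component_clopen _ C (Solw_closed F K HKcl HGc) HC HCb)
    as (A & HA & [M HM] & HAne).
  assert (HSb : forall x, Solw F K x -> vnorm x <= M).
  { intros x Hx. now apply HM, (Hfull A HA (ex_intro _ M HM) HAne). }
  apply Hdisc. intros (U & V & HU & HV & Hcov & [p [Sp Up]] & [q [Sq Vq]] & Hd).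
  destruct (Hfull (fun x => Solw F K x /\ U x)) with q as [_ Uq]; try assumption.
  - now apply clopen_of_separation with V.
  - exists M. intros x [Sx _]. now apply HSb.
  - now exists p.
  - exact (Hd q Sq Uq Vq).
Qed.
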